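(* Let $k,\hat n,\tilde n\ge1$ be integers, let $n=\hat n\cdot\tilde n$, and let $B\in\mathbb{R}^{n\times n}$ be symmetric positive semi-definite. Let $\tilde x_1,\ldots,\tilde x_k$ (with values in $\mathbb{R}^{\tilde n}$) and $\hat x_1,\ldots,\hat x_k$ (with values in $\mathbb{R}^{\hat n}$) be $2k$ independent Rademacher random vectors, and let $$\mathsf{Est}_k=\frac1k\sum_{i=1}^k(\tilde x_i\otimes\hat x_i)^TB(\tilde x_i\otimes\hat x_i).$$ Let $\varepsilon>0$ and suppose that $n-1\ge48\cdot\varepsilon^{-1}$. Then the bound $$\operatorname{trace}(B)\ge\frac{1}{1+\varepsilon}\,\mathsf{Est}_k$$ holds with probability at least $1-\exp(-k\varepsilon/(n-1))$.
   Context: $\otimes$ denotes the Kronecker product. A Rademacher vector is a random vector whose entries are independent and take the values $1$ and $-1$, each with probability $1/2$. *)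

(* Defs.v *)
From HB Require Import structures.
From mathcomp Require Import all_boot all_order all_algebra.
From mathcomp Require Import all_classical all_reals all_analysis.
From mathcomp Require Export mxtens.

Set Implicit Arguments.
Unset Strict Implicit.
Unset Printing Implicit Defensive.

Import Order.TTheory GRing.Theory Num.Theory.
Import numFieldNormedType.Exports.

Local Open Scope classical_set_scope.
Local Open Scope ring_scope.

Definition qform (R : realType) (n : nat) (B : 'M[R]_n) (x : 'cV[R]_n) : R :=
  (x^T *m B *m x) ord0 ord0.

Definition symmetric_psd (R : realType) (n : nat) (B : 'M[R]_n) : Prop :=
  B^T = B /\ forall x : 'cV[R]_n, 0 <= qform B x.

Section Independence.
Context (d : measure_display) (T : measurableType d) (R : realType).
Variable P : probability T R.

(* Mutual independence of a finite family of systems of events. Random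
   variables X i, possibly with values in different spaces, are independent
   when this holds for F i := g_sigma_algebra_preimage (X i), the sigma-algebra
   generated by X i. *)
Definition mutually_independent (I : finType) (F : I -> set (set T)) : Prop :=
  forall (J : {set I}) (E : I -> set T),
    (forall i, i \in J -> F i (E i)) ->
    P (\bigcap_(i in [set` J]) E i) = (\prod_(i in J) P (E i))%E.

Definition rademacher (n : nat) (X : {RV P >-> n.-tuple R}) : Prop :=
  mutually_independent
    (fun j : 'I_n => g_sigma_algebra_preimage (fun w => tnth (X w) j)) /\
  forall j : 'I_n,
    P [set w | tnth (X w) j = 1] = (2^-1)%:E /\
    P [set w | tnth (X w) j = -1] = (2^-1)%:E.

Definition independent_vectors (k m n : nat)
    (X : 'I_k -> {RV P >-> m.-tuple R}) (Y : 'I_k -> {RV P >-> n.-tuple R}) :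
    Prop :=
  mutually_independent (fun s : 'I_k + 'I_k =>
    match s with
    | inl i => g_sigma_algebra_preimage (X i)
    | inr i => g_sigma_algebra_preimage (Y i)
    end).

End Independence.

(* Random vectors are tuples, which carry the product Borel sigma-algebra. *)
Definition colvec (R : realType) (n : nat) (x : n.-tuple R) : 'cV[R]_n :=
  \col_(i < n) tnth x i.

(* x *t y is the Kronecker product, with the usual row-major ordering: the
   entry x_i * y_j has index i * nh + j. *)
Definition Est (R : realType) (d : measure_display) (T : measurableType d)
    (P : probability T R) (k nt nh : nat) (B : 'M[R]_(nt * nh))
    (xt : 'I_k -> {RV P >-> nt.-tuple R})
    (xh : 'I_k -> {RV P >-> nh.-tuple R}) : T -> R :=
  fun w => k%:R^-1 *
    \sum_(i < k) qform B (colvec (xt i w) *t colvec (xh i w)).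

(* Main.v *)
Require Import Defs.
From mathcomp Require Import all_boot all_order all_algebra.
From mathcomp Require Import all_classical all_reals all_analysis.
From mathcomp Require Import measurable_realfun ring lra.

Import Order.TTheory GRing.Theory Num.Theory.
Import numFieldNormedType.Exports.

Local Open Scope classical_set_scope.
Local Open Scope ring_scope.

(** Write tau for the trace of B, X for the Kronecker product of two independent
    Rademacher vectors, and q = X^T B X. The bound is a Bernstein inequality for
    the mean of k independent copies of q, fed by three facts:

    - E q = tau, because the entries of X are uncorrelated with unit variance;
    - q <= n tau, because |X|^2 = n and the largest eigenvalue of B is at most
      tau; so q - tau <= (n - 1) tau;
    - E q^2 <= 9 tau^2, hence Var q <= 8 tau^2.

    All three are checked for B = v v^T and pass to sums of such matrices
    ([kron_form_bounds]); the induction principle [psd_ind] says that every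
    positive semi-definite matrix is such a sum. For E q^2 the passage to sums is
    Minkowski's inequality in L^2, and the rank one case is the fourth moment
    Khintchine inequality E (sum_i w_i e_i)^4 <= 3 (sum_i w_i^2)^2, used once for
    each of the two tensor factors; this gives the factor 9 = 3 * 3.

    If tau = 0, then q <= 0 and there is nothing to bound. Otherwise, with
    m = n - 1, the exponential moment at t = 3 / (2 m tau) is bounded by
    E exp (t (q - tau)) <= 1 + 4/3 t^2 Var q <= exp (24 / m^2), since
    exp y <= 1 + y + 4/3 y^2 for y <= 3/2. The Chernoff bound for the mean then
    costs, for each copy, exp (24 / m^2 - t eps tau), where
    t eps tau = 3/2 eps / m, and m eps >= 48 makes 24 / m^2 <= eps / (2 m):
    what remains is exp (- eps / m).

    The computations take place on finite sets of sign patterns, where an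
    expectation is a sum divided by a cardinality. The probability space enters
    at the end: each of the sign patterns for the 2 k vectors is an event
    of the same probability, these events are disjoint, and so the probability of
    a measurable event is at least the proportion of the patterns that lie in it
    ([prob_ge_card]). *)

Set Implicit Arguments.
Unset Strict Implicit.
Unset Printing Implicit Defensive.

(** * Positive semi-definite matrices as sums of rank one matrices *)

Lemma qform_eq_sum (R : realType) n (B : 'M[R]_n) x :
  qform B x = \sum_i \sum_j x i 0 * B i j * x j 0.
Proof.
rewrite /qform mxE exchange_big /=; apply: eq_bigr => j _.
rewrite mxE big_distrl /=; apply: eq_bigr => i _.
by rewrite !mxE.
Qed.

Lemma qformD (R : realType) n (B C : 'M[R]_n) x :
  qform (B + C) x = qform B x + qform C x.
Proof. by rewrite /qform mulmxDr mulmxDl mxE. Qed.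

Lemma qform0 (R : realType) n (x : 'cV[R]_n) : qform 0 x = 0.
Proof. by rewrite /qform mulmx0 mul0mx mxE. Qed.

Lemma qform_rank_one (R : realType) n (v x : 'cV[R]_n) :
  qform (v *m v^T) x = (\sum_i v i 0 * x i 0) ^+ 2.
Proof.
rewrite /qform mulmxA -mulmxA mxE big_ord1 expr2.
by congr (_ * _); rewrite mxE; apply: eq_bigr => i _; rewrite !mxE // mulrC.
Qed.

Lemma tr_rank_one (R : realType) n (v : 'cV[R]_n) :
  \tr (v *m v^T) = \sum_i v i 0 ^+ 2.
Proof. by apply: eq_bigr => i _; rewrite mxE big_ord1 mxE expr2. Qed.

Lemma qformD_delta (R : realType) n (B : 'M[R]_n) x (t : R) i : B^T = B ->
  qform B (x + t *: delta_mx i 0) =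
  qform B x + 2 * t * (B *m x) i 0 + t ^+ 2 * B i i.
Proof.
move=> symB.
have eB (y : 'cV[R]_n) : ((delta_mx i 0 : 'cV[R]_n)^T *m B *m y) ord0 ord0 = (B *m y) i 0.
  by rewrite trmx_delta -mulmxA -rowE !mxE.
have Be : (x^T *m B *m (delta_mx i 0 : 'cV[R]_n)) ord0 ord0 = (B *m x) i 0.
  by rewrite -{1}symB -trmx_mul -colE !mxE.
have De : (B *m (delta_mx i 0 : 'cV[R]_n)) i 0 = B i i by rewrite -colE mxE.
rewrite /qform.
have -> : (x + t *: delta_mx i 0)^T = x^T + t *: (delta_mx i 0 : 'cV[R]_n)^T.
  by rewrite linearD /= linearZ.
rewrite !mulmxDl !mulmxDr -!scalemxAl -!scalemxAr.
have addE (C D : 'M[R]_1) : (C + D) ord0 ord0 = C ord0 ord0 + D ord0 ord0.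
  by rewrite mxE.
have scaleE (c : R) (C : 'M[R]_1) : (c *: C) ord0 ord0 = c * C ord0 ord0.
  by rewrite mxE.
rewrite !(addE, scaleE) Be !eB De.
ring.
Qed.

Lemma qform_delta (R : realType) n (B : 'M[R]_n) i : B^T = B ->
  qform B (delta_mx i 0) = B i i.
Proof.
move=> symB; have := qformD_delta 0 1 i symB.
rewrite add0r scale1r => ->.
by rewrite /qform !mulmx0 !mxE mulr0 !add0r expr1n mul1r.
Qed.

Lemma psd_diag_ge0 (R : realType) n (B : 'M[R]_n) i :
  symmetric_psd B -> 0 <= B i i.
Proof. by move=> [symB posB]; rewrite -qform_delta. Qed.

(** If the diagonal vanishes, then the form takes the value - 2 (B i j)^2 at
    e_j - (B i j) e_i. *)
Lemma psd_diag0 (R : realType) n (B : 'M[R]_n) :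
  symmetric_psd B -> (forall i, B i i = 0) -> B = 0.
Proof.
move=> [symB posB] B0; apply/matrixP => i j; rewrite [RHS]mxE.
have := posB (delta_mx j 0 + (- B i j) *: delta_mx i 0).
rewrite qformD_delta // qform_delta // !B0 -colE mxE mulr0 addr0 add0r => h.
by apply/eqP; rewrite -sqrf_eq0 eq_le sqr_ge0 andbT; nra.
Qed.

(** The Schur complement step, iterated: if B i i > 0, then subtracting v v^T with
    v = B e_i / sqrt (B i i) clears row and column i, keeps the diagonal
    zeros, and leaves a positive semi-definite matrix, whose value at x is the
    minimum of the form of B on the line x + R e_i. The induction is on the number
    of nonzero diagonal entries, which keeps the dimension fixed. *)
Lemma psd_ind (R : realType) n (Q : 'M[R]_n -> Prop) :
  Q 0 ->
  (forall (v : 'cV[R]_n) B, Q B -> Q (v *m v^T + B)) ->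
  forall B, symmetric_psd B -> Q B.
Proof.
move=> Q0 QD B; have [m] := ubnP #|[pred i | B i i != 0]|.
elim: m B => // m IH B cardB psdB; have [symB posB] := psdB.
have [allz|] := boolP [forall i, B i i == 0].
  by rewrite (psd_diag0 psdB) // => i; apply/eqP/(forallP allz).
rewrite negb_forall => /existsP[i Bi0].
have Bi_gt0 : 0 < B i i by rewrite lt_def Bi0 psd_diag_ge0.
pose v := (Num.sqrt (B i i))^-1 *: col i B.
have vE j : v j 0 ^+ 2 = (B i i)^-1 * B j i ^+ 2.
  by rewrite !mxE exprMn exprVn sqr_sqrtr // ltW.
have Bsym j : B j i = B i j by rewrite -{1}symB mxE.
have qv (x : 'cV[R]_n) : (\sum_j v j 0 * x j 0) ^+ 2 = (B i i)^-1 * (B *m x) i 0 ^+ 2.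
  have -> : \sum_j v j 0 * x j 0 = (Num.sqrt (B i i))^-1 * (B *m x) i 0.
    rewrite mxE big_distrr /=; apply: eq_bigr => j _.
    by rewrite !mxE -mulrA Bsym.
  by rewrite exprMn exprVn sqr_sqrtr // ltW.
pose C := B - v *m v^T.
have BE : B = v *m v^T + C by rewrite addrC subrK.
have psdC : symmetric_psd C.
  split; first by rewrite linearB /= trmx_mul trmxK symB.
  (* x - s e_i minimizes the form of B on the line x + R e_i. *)
  move=> x; set s := (B *m x) i 0 / B i i.
  have := posB (x + (- s) *: delta_mx i 0).
  rewrite qformD_delta // {1}BE qformD qform_rank_one qv.
  suff -> : (B i i)^-1 * (B *m x) i 0 ^+ 2 + qform C x + 2 * - s * (B *m x) i 0
            + (- s) ^+ 2 * B i i = qform C x by [].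
  by rewrite /s; field; rewrite gt_eqF.
have CE j : C j j = B j j - v j 0 ^+ 2.
  by rewrite !mxE big_ord1 !mxE expr2.
rewrite BE; apply/QD/IH => //.
apply: (@leq_trans #|[pred i | B i i != 0]|); last by rewrite -ltnS.
apply/proper_card/properP; split.
  apply/fintype.subsetP => j; rewrite !inE; apply: contra => /eqP Bj0.
  have := psd_diag_ge0 j psdC; rewrite CE Bj0 sub0r oppr_ge0 => v0.
  by rewrite oppr_eq0 eq_le v0 sqr_ge0.
exists i; rewrite !inE // negbK CE vE.
by rewrite expr2 mulKf ?subrr // gt_eqF.
Qed.

(** * Moments of sums of random signs *)

Definition flip (I : finType) (i : I) (a : {ffun I -> bool}) : {ffun I -> bool} :=
  [ffun j => (j == i) (+) a j].

Lemma flip_inj (I : finType) (i : I) : injective (flip i).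
Proof.
apply: (can_inj (g := flip i)) => a.
by apply/ffunP => j; rewrite !ffunE addbA addbb.
Qed.

(** Flipping the sign a i pairs each term with its opposite. This replaces the
    independence of the signs in moment computations. *)
Lemma sum_signM_flip0 (R : numDomainType) (I : finType) (i : I)
    (g : {ffun I -> bool} -> R) :
  (forall a, g (flip i a) = g a) -> \sum_(a : {ffun I -> bool}) (-1) ^+ a i * g a = 0.
Proof.
move=> gflip; set S := \sum_(_ : _) _; have : S = - S.
  rewrite {1}/S (reindex_inj (@flip_inj _ i)) /= -sumrN; apply: eq_bigr => a _.
  by rewrite gflip ffunE eqxx addTb signrN mulNr.
by move/eqP; rewrite -subr_eq0 opprK -mulr2n mulrn_eq0 /= => /eqP.
Qed.

(** Summing over a sequence of indices, rather than over all of I, allows an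
    induction on the number of terms with the type of sign patterns fixed. *)
Definition signsum (R : numDomainType) (I : finType) (w : I -> R) (r : seq I)
    (a : {ffun I -> bool}) : R :=
  \sum_(i <- r) w i * (-1) ^+ a i.

Lemma signsum_flip (R : numDomainType) (I : finType) (w : I -> R) r i a :
  i \notin r -> signsum w r (flip i a) = signsum w r a.
Proof.
move=> ir; apply: eq_big_seq => j jr; rewrite ffunE.
by rewrite (negbTE (memPn ir j jr)).
Qed.

(** Khintchine's inequality for the fourth moment. A new term u e adds 6 u^2 S^2 + u^4
    to the mean of S^4, odd powers of the sign e averaging to zero, while
    3 V^2 grows by 6 u^2 V + 3 u^4, where V is the mean of S^2. *)
Lemma signsum_moments (R : realDomainType) (I : finType) (w : I -> R) r : uniq r ->
  \sum_a signsum w r a ^+ 2 =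
    #|{ffun I -> bool}|%:R * \sum_(i <- r) w i ^+ 2 /\
  \sum_a signsum w r a ^+ 4 <=
    3 * #|{ffun I -> bool}|%:R * (\sum_(i <- r) w i ^+ 2) ^+ 2.
Proof.
elim: r => [|i r IH] /=.
  rewrite !big_nil expr0n /= ?mulr0n !mulr0.
  by rewrite !big1 // => a _; rewrite /signsum big_nil expr0n.
case/andP=> ir /IH[IH2 IH4].
set V := \sum_(j <- r) _ in IH2 IH4; set N := #|_|%:R in IH2 IH4 *.
rewrite big_cons -/V.
have consE a : signsum w (i :: r) a = signsum w r a + w i * (-1) ^+ a i.
  by rewrite /signsum big_cons addrC.
have sqr1 (a : {ffun I -> bool}) : ((-1) ^+ a i) ^+ 2 = 1 :> R.
  by rewrite sqrr_sign.
have odd1 : \sum_(a : {ffun I -> bool}) (-1) ^+ a i * signsum w r a = 0.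
  by apply: sum_signM_flip0 => a; rewrite signsum_flip.
have odd3 : \sum_(a : {ffun I -> bool}) (-1) ^+ a i * signsum w r a ^+ 3 = 0.
  by apply: sum_signM_flip0 => a; rewrite signsum_flip.
split.
  under eq_bigr => a _.
    have -> : signsum w (i :: r) a ^+ 2 = signsum w r a ^+ 2 +
       2 * w i * ((-1) ^+ a i * signsum w r a) + w i ^+ 2.
      by rewrite consE; have := sqr1 a; move: ((-1) ^+ a i) => e e2; ring: e2.
    over.
  rewrite !big_split /= -mulr_sumr odd1 IH2 sumr_const -mulr_natl -/N.
  ring.
under eq_bigr => a _.
  have -> : signsum w (i :: r) a ^+ 4 = signsum w r a ^+ 4 +
      4 * w i * ((-1) ^+ a i * signsum w r a ^+ 3) +
      6 * w i ^+ 2 * signsum w r a ^+ 2 +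
      4 * w i ^+ 3 * ((-1) ^+ a i * signsum w r a) + w i ^+ 4.
    by rewrite consE; have := sqr1 a; move: ((-1) ^+ a i) => e e2; ring: e2.
  over.
rewrite !big_split /= -!mulr_sumr odd1 odd3 IH2 sumr_const -mulr_natl -/N.
have N0 : 0 <= N by rewrite ler0n.
have := mulr_ge0 N0 (exprn_even_ge0 (w i) (isT : ~~ odd 4)).
move: IH4; set S4 := \sum_a _; move: (w i) => u; nra.
Qed.

(** Minkowski's inequality in L^2 in squared form, with c standing for the
    squared constant. For s, t > 0 it follows from the pointwise convexity bound
    (f + g)^2 <= (s + t) (f^2 / s + g^2 / t). *)
Lemma sum_sqrD_le (R : realFieldType) (U : finType) (f g : U -> R) (c s t : R) :
  0 <= c -> 0 <= s -> 0 <= t ->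
  \sum_u f u ^+ 2 <= c * s ^+ 2 -> \sum_u g u ^+ 2 <= c * t ^+ 2 ->
  \sum_u (f u + g u) ^+ 2 <= c * (s + t) ^+ 2.
Proof.
move=> c0 s0 t0 hf hg.
have eq0 (h : U -> R) : \sum_u h u ^+ 2 <= c * 0 ^+ 2 -> forall u, h u = 0.
  rewrite expr0n mulr0 => h0 u; apply/eqP; rewrite -sqrf_eq0.
  have : \sum_u h u ^+ 2 == 0 by rewrite eq_le h0 sumr_ge0 // => v _; rewrite sqr_ge0.
  rewrite psumr_eq0 => [/allP/(_ u (mem_index_enum u))//|v _].
  exact: sqr_ge0.
have [s00|sn0] := eqVneq s 0.
  move: hf; rewrite s00 add0r => /eq0 f0.
  by under eq_bigr => u _ do rewrite f0 add0r.
have [t00|tn0] := eqVneq t 0.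
  move: hg; rewrite t00 addr0 => /eq0 g0.
  by under eq_bigr => u _ do rewrite g0 addr0.
have {sn0}s0 : 0 < s by rewrite lt_def sn0.
have {tn0}t0 : 0 < t by rewrite lt_def tn0.
apply: le_trans (_ : \sum_u ((s + t) / s * f u ^+ 2 + (s + t) / t * g u ^+ 2) <= _).
  apply: ler_sum => u _; rewrite -subr_ge0.
  have -> : (s + t) / s * f u ^+ 2 + (s + t) / t * g u ^+ 2 - (f u + g u) ^+ 2 =
     (s * t)^-1 * (t * f u - s * g u) ^+ 2.
    by field; rewrite !gt_eqF.
  by rewrite mulr_ge0 ?sqr_ge0 // invr_ge0 mulr_ge0 // ltW.
rewrite big_split /= -!mulr_sumr.
have -> : c * (s + t) ^+ 2 = (s + t) / s * (c * s ^+ 2) + (s + t) / t * (c * t ^+ 2).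
  by field; rewrite !gt_eqF.
by apply: lerD; apply: ler_wpM2l => //; rewrite divr_ge0 ?addr_ge0 // ltW.
Qed.

Lemma sum_sqr_sum_le (R : realFieldType) (U I : finType) (f : I -> U -> R)
    (c : R) (s : I -> R) :
  0 <= c -> (forall i, 0 <= s i) ->
  (forall i, \sum_u f i u ^+ 2 <= c * s i ^+ 2) ->
  \sum_u (\sum_i f i u) ^+ 2 <= c * (\sum_i s i) ^+ 2.
Proof.
move=> c0 s0 hf; elim: (index_enum I) => [|i r IH].
  by rewrite big1 => [|u _]; rewrite big_nil expr0n ?mulr0.
rewrite big_cons; under [leLHS]eq_bigr => u _ do rewrite big_cons.
by apply: sum_sqrD_le => //; rewrite sumr_ge0.
Qed.

Lemma sqr_sum_le (R : realDomainType) (I : finType) (y : I -> R) :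
  (\sum_i y i) ^+ 2 <= #|I|%:R * \sum_i y i ^+ 2.
Proof.
have : 0 <= \sum_i \sum_j (y i - y j) ^+ 2.
  by apply: sumr_ge0 => i _; apply: sumr_ge0 => j _; apply: sqr_ge0.
have -> : \sum_i \sum_j (y i - y j) ^+ 2 =
    2 * (#|I|%:R * \sum_i y i ^+ 2 - (\sum_i y i) ^+ 2).
  under eq_bigr => i _.
    under eq_bigr => j _ do rewrite sqrrB.
    rewrite big_split /= sumrB sumr_const sumrMnl -mulr_sumr.
    over.
  rewrite big_split /= sumrB !sumrMnl -mulr_suml sumr_const -[_ *+ 2]mulr_natl -[_ *+ #|_|]mulr_natl.
  ring.
lra.
Qed.

(** * The quadratic form at Kronecker products of sign vectors *)

Notation signs m n := ({ffun 'I_m -> bool} * {ffun 'I_n -> bool})%type.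

Definition signvec (R : realType) n (a : {ffun 'I_n -> bool}) : 'cV[R]_n :=
  \col_i (-1) ^+ a i.

Definition kron_form (R : realType) m n (B : 'M[R]_(m * n)) (u : signs m n) : R :=
  qform B (signvec R u.1 *t signvec R u.2).

Lemma sum_mxtens (V : nmodType) m n (F : 'I_(m * n) -> V) :
  \sum_p F p = \sum_i \sum_j F (mxtens_index (i, j)).
Proof.
rewrite (pair_bigA _ (fun i j => F (mxtens_index (i, j)))) /=.
rewrite (reindex (@mxtens_index m n)) /=; first by apply: eq_bigr => -[].
by exists (@mxtens_unindex m n) => i _; rewrite (mxtens_indexK, mxtens_unindexK).
Qed.

(** For a rank one matrix the form is a square of nested sign sums, so that the
    moment bounds apply to one tensor factor at a time. *)
Lemma kron_form_rank_one (R : realType) m n (v : 'cV[R]_(m * n)) u :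
  kron_form (v *m v^T) u =
  signsum (fun i => signsum (fun j => v (mxtens_index (i, j)) 0)
                            (index_enum 'I_n) u.2) (index_enum 'I_m) u.1 ^+ 2.
Proof.
rewrite /kron_form qform_rank_one; congr (_ ^+ 2).
rewrite sum_mxtens; apply: eq_bigr => i _; rewrite mulr_suml; apply: eq_bigr => j _.
by rewrite mxE mxtens_indexK !mxE -mulrA [in RHS](mulrC (_ ^+ _)).
Qed.

Lemma sum_sqr_mxtens (R : realType) m n (v : 'cV[R]_(m * n)) :
  \sum_i \sum_j v (mxtens_index (i, j)) 0 ^+ 2 = \tr (v *m v^T).
Proof. by rewrite tr_rank_one sum_mxtens. Qed.

(** Each clause holds for v v^T by Cauchy-Schwarz and the moments of sign sums, and
    is stable under addition of matrices: the first three are linear in B, and the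
    last is a bound on an L^2 norm by a linear function of B. *)
Lemma kron_form_bounds (R : realType) m n (B : 'M[R]_(m * n)) :
  symmetric_psd B ->
  [/\ 0 <= \tr B,
      forall u, kron_form B u <= (m * n)%:R * \tr B,
      \sum_u kron_form B u = #|{: signs m n}|%:R * \tr B &
      \sum_u kron_form B u ^+ 2 <= 9 * #|{: signs m n}|%:R * \tr B ^+ 2].
Proof.
move: B; apply: psd_ind.
  rewrite linear0; split => //.
  - by move=> u; rewrite mulr0 /kron_form qform0.
  - by rewrite mulr0 big1 // => u _; rewrite /kron_form qform0.
  - by rewrite expr0n mulr0 big1 // => u _; rewrite /kron_form qform0 expr0n.
move=> v B [tr0 le_tr sum1 sum2]; rewrite linearD /=.
have kD u : kron_form (v *m v^T + B) u = kron_form (v *m v^T) u + kron_form B u.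
  exact: qformD.
set N := #|_|%:R in sum1 sum2 *; have N0 : 0 <= N by rewrite ler0n.
pose N1 : R := #|{ffun 'I_m -> bool}|%:R; pose N2 : R := #|{ffun 'I_n -> bool}|%:R.
have NE : N = N1 * N2 by rewrite -natrM -card_prod.
have trv0 : 0 <= \tr (v *m v^T).
  by rewrite tr_rank_one sumr_ge0 // => i _; rewrite sqr_ge0.
pose w i b := signsum (fun j => v (mxtens_index (i, j)) 0) (index_enum 'I_n) b.
have uniqm := index_enum_uniq 'I_m; have uniqn := index_enum_uniq 'I_n.
have sumU (f : {ffun 'I_m -> bool} -> {ffun 'I_n -> bool} -> R) :
    \sum_(u : signs m n) f u.1 u.2 = \sum_b \sum_a f a b.
  by rewrite exchange_big (pair_bigA _ f).
split.
- exact: addr_ge0.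
- move=> u; rewrite kD mulrDr lerD //.
  rewrite /kron_form qform_rank_one tr_rank_one.
  (* The entries of X are signs, so the Cauchy-Schwarz inequality gives n |v|^2. *)
  apply: le_trans (sqr_sum_le _) _; rewrite card_ord.
  rewrite ler_wpM2l ?ler0n // ler_sum // => p _.
  rewrite exprMn; suff -> : (signvec R u.1 *t signvec R u.2) p 0 ^+ 2 = 1 by rewrite mulr1.
  by rewrite !mxE exprMn !sqrr_sign mulr1.
- under eq_bigr => u _ do rewrite kD kron_form_rank_one.
  rewrite big_split /= sum1 mulrDr; congr (_ + _).
  rewrite (sumU (fun a b => signsum (w^~ b) (index_enum 'I_m) a ^+ 2)).
  under eq_bigr => b _ do rewrite (signsum_moments _ uniqm).1.
  rewrite -mulr_sumr exchange_big /=.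
  under eq_bigr => i _ do rewrite (signsum_moments _ uniqn).1.
  by rewrite -mulr_sumr sum_sqr_mxtens NE mulrA.
- (* Khintchine in the first factor, then in the second one for each row of v. *)
  under eq_bigr => u _ do rewrite kD.
  apply: sum_sqrD_le => //; first by rewrite mulr_ge0.
  under eq_bigr => u _ do rewrite kron_form_rank_one -exprM.
  rewrite (sumU (fun a b => signsum (w^~ b) (index_enum 'I_m) a ^+ 4)).
  apply: le_trans (_ : \sum_b 3 * N1 * (\sum_i w i b ^+ 2) ^+ 2 <= _).
    by apply: ler_sum => b _; exact: (signsum_moments _ uniqm).2.
  rewrite -mulr_sumr NE.
  have -> : 9 * (N1 * N2) = (3 * N1) * (3 * N2) by ring.
  rewrite -[leRHS]mulrA ler_wpM2l ?mulr_ge0 ?ler0n // -sum_sqr_mxtens.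
  apply: sum_sqr_sum_le.
  + by rewrite mulr_ge0 ?ler0n.
  + by move=> i; rewrite sumr_ge0 // => j _; rewrite sqr_ge0.
  + move=> i; under eq_bigr => b _ do rewrite -exprM.
    exact: (signsum_moments _ uniqn).2.
Qed.

(** * Bernstein's inequality for uniform draws from a finite set *)

(** Squaring exp x <= 1 + x + x^2 at x = y / 2 <= 3/4, which in turn follows from
    exp t <= 1 / (1 - t) at t = y / 8. For y <= 0, the bound 1 / (1 - y) is enough. *)
Lemma expR_le_quadratic (R : realType) (y : R) :
  y <= 3 / 2 -> expR y <= 1 + y + 4 / 3 * y ^+ 2.
Proof.
have expR_le_inv (x : R) : x < 1 -> expR x <= (1 - x)^-1.
  move=> x1; rewrite -[expR x]invrK -expRN lef_pV2 ?posrE ?expR_gt0 ?subr_gt0 //.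
  exact: expR_ge1Dx.
move=> y32; have [y0|y0] := leP y 0.
  apply: le_trans (expR_le_inv _ (le_lt_trans y0 ltr01)) _.
  rewrite -[leLHS]mul1r ler_pdivrMr; last lra.
  have := exprn_even_ge0 y (isT : ~~ odd 2).
  have := mulr_ge0 (sqr_ge0 y) (_ : 0 <= - y); nra.
have halfE (x : R) : expR x = expR (x / 2) ^+ 2.
  by rewrite -expRM_natl; congr expR; field.
have half_le : expR (y / 2) <= 1 + y / 2 + (y / 2) ^+ 2.
  set t := y / 8; have -> : y / 2 = 4 * t by rewrite /t; field.
  have t0 : 0 <= t by rewrite divr_ge0 // ltW.
  have t1 : t <= 3 / 16 by rewrite /t; lra.
  clearbody t.
  rewrite expRM_natl.
  apply: (@le_trans _ _ ((1 - t)^-1 ^+ 4)).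
    by rewrite lerXn2r ?nnegrE ?expR_ge0 ?invr_ge0 ?expR_le_inv //; lra.
  rewrite exprVn -[leLHS]mul1r ler_pdivrMr ?exprn_gt0; try lra.
  (* (1 - t)^4 (1 + 4 t + 16 t^2) - 1 is t^2 times this cubic, plus 16 t^6. *)
  have h : 0 <= 6 - 44 * t + 81 * t ^+ 2 - 60 * t ^+ 3.
    have h3 : 0 <= t ^+ 2 * (3 / 16 - t) by rewrite mulr_ge0 ?sqr_ge0 ?subr_ge0.
    have h2 : 0 <= (3 / 16 - t) ^+ 2 by exact: sqr_ge0.
    nra.
  have := mulr_ge0 (sqr_ge0 t) h; have := exprn_ge0 6 t0.
  nra.
rewrite halfE; apply: (@le_trans _ _ ((1 + y / 2 + (y / 2) ^+ 2) ^+ 2)).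
  by rewrite lerXn2r ?nnegrE ?expR_ge0 // addr_ge0 ?sqr_ge0 //; lra.
have h : 0 <= 7 / 12 - y / 4 - y ^+ 2 / 16 by nra.
have := mulr_ge0 (sqr_ge0 y) h; nra.
Qed.

(** The choice of t makes t (q - s) <= 3/2, the range of the quadratic
    bound on exp. The linear term averages to zero, and the quadratic one to at most
    4/3 t^2 (9 - 1) s^2 = 24 / m^2. *)
Lemma sum_expR_le (R : realType) (U : finType) (q : U -> R) (m s : R) :
  0 < m -> 0 < s -> (forall u, q u <= (m + 1) * s) ->
  \sum_u q u = #|U|%:R * s -> \sum_u q u ^+ 2 <= 9 * #|U|%:R * s ^+ 2 ->
  \sum_u expR (3 / (2 * m * s) * (q u - s)) <= #|U|%:R * expR (24 / m ^+ 2).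
Proof.
move=> m0 s0 qmax sum1 sum2; set N := #|U|%:R in sum1 sum2 *.
have sumN (x : R) : \sum_(u : U) x = N * x by rewrite sumr_const mulr_natl.
set t := 3 / (2 * m * s).
have t0 : 0 < t by rewrite divr_gt0 // !mulr_gt0.
have quad : \sum_u expR (t * (q u - s)) <=
    \sum_u (1 + t * (q u - s) + 4 / 3 * (t * (q u - s)) ^+ 2).
  apply: ler_sum => u _; apply: expR_le_quadratic.
  have -> : 3 / 2 = t * (m * s) by rewrite /t; field; rewrite !gt_eqF.
  by rewrite ler_pM2l // lerBlDr; have := qmax u; rewrite mulrDl mul1r.
apply: le_trans quad _.
have -> : \sum_u (1 + t * (q u - s) + 4 / 3 * (t * (q u - s)) ^+ 2) =
    N + 4 / 3 * t ^+ 2 * (\sum_u q u ^+ 2 - N * s ^+ 2).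
  transitivity (\sum_u ((1 - t * s + 4 / 3 * t ^+ 2 * s ^+ 2) +
      (t - 8 / 3 * t ^+ 2 * s) * q u + 4 / 3 * t ^+ 2 * q u ^+ 2)).
    by apply: eq_bigr => u _; field.
  rewrite big_split big_split /= -!mulr_sumr sumN sum1; ring.
have -> : N * expR (24 / m ^+ 2) = N * expR (4 / 3 * t ^+ 2 * (8 * s ^+ 2)).
  by congr (_ * expR _); rewrite /t; field; rewrite !gt_eqF.
apply: le_trans (_ : N * (1 + 4 / 3 * t ^+ 2 * (8 * s ^+ 2)) <= _).
  have c0 : 0 <= 4 / 3 * t ^+ 2 by rewrite mulr_ge0 // sqr_ge0.
  rewrite [leRHS]mulrDr mulr1 lerD2l [leRHS]mulrCA ler_wpM2l //.
  rewrite lerBlDr; apply: le_trans sum2 _; rewrite le_eqVlt; apply/orP; left; apply/eqP.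
  ring.
by rewrite ler_wpM2l ?ler0n // expR_ge1Dx.
Qed.

(** The Chernoff bound for k independent uniform draws from U. Independence is the
    product formula for sums over functions from 'I_k to U. *)
Lemma card_sum_gt_le (R : realType) (U : finType) (q : U -> R) (m s eps : R) k :
  0 < m -> 0 <= s -> 0 < eps -> 48 <= m * eps ->
  (forall u, q u <= (m + 1) * s) ->
  \sum_u q u = #|U|%:R * s -> \sum_u q u ^+ 2 <= 9 * #|U|%:R * s ^+ 2 ->
  #|[pred f : {ffun 'I_k -> U} | k%:R * ((1 + eps) * s) < \sum_i q (f i)]|%:R <=
    #|U|%:R ^+ k * expR (- (k%:R * eps / m)).
Proof.
move=> m0 s0 eps0 meps qmax sum1 sum2.
(* If s = 0 then q <= 0, and no sum exceeds 0. *)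
have [sz|sn0] := eqVneq s 0.
  rewrite sz eq_card0 => [|f]; first by rewrite mulr_ge0 ?expR_ge0 // exprn_ge0.
  rewrite !inE !mulr0; apply/negbTE; rewrite -leNgt; apply: sumr_le0 => i _.
  by have := qmax (f i); rewrite sz mulr0.
have {sn0}s0 : 0 < s by rewrite lt_def sn0.
have mgf := sum_expR_le m0 s0 qmax sum1 sum2.
set t := 3 / (2 * m * s) in mgf.
have t0 : 0 < t by rewrite divr_gt0 // !mulr_gt0.
apply: (@le_trans _ _
  (\sum_(f : {ffun 'I_k -> U}) \prod_i (expR (- (t * eps * s)) * expR (t * (q (f i) - s))))).
  rewrite -sum1_card natr_sum big_mkcond /=; apply: ler_sum => f _.
  under eq_bigr => i _ do rewrite -expRD.
  rewrite -expR_sum inE; case: ifP => [bad|_]; last exact: expR_ge0.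
  rewrite -expR0 ler_expR.
  have -> : \sum_i (- (t * eps * s) + t * (q (f i) - s)) =
      t * (\sum_i q (f i) - k%:R * ((1 + eps) * s)).
    rewrite mulrBr mulr_sumr -[in X in _ - X](card_ord k) mulr_natl -sumr_const.
    rewrite mulr_sumr -sumrB; apply: eq_bigr => i _; ring.
  by rewrite mulr_ge0 ?subr_ge0 // ltW.
rewrite -(bigA_distr_bigA (fun (i : 'I_k) u =>
   expR (- (t * eps * s)) * expR (t * (q u - s)))) /=.
rewrite prodr_const card_ord -mulr_sumr.
have -> : expR (- (k%:R * eps / m)) = expR (- (eps / m)) ^+ k.
  by rewrite -expRM_natl; congr expR; ring.
have sum0 : 0 <= \sum_u expR (t * (q u - s)) by rewrite sumr_ge0 // => u _; exact: expR_ge0.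
rewrite -exprMn lerXn2r ?nnegrE ?mulr_ge0 ?expR_ge0 //.
apply: le_trans (_ : expR (- (t * eps * s)) * (#|U|%:R * expR (24 / m ^+ 2)) <= _).
  by rewrite ler_wpM2l ?expR_ge0.
rewrite mulrCA ler_wpM2l // -expRD ler_expR.
have -> : t * eps * s = 3 / 2 * (eps / m) by rewrite /t; field; rewrite !gt_eqF.
(* The exponent 3/2 eps / m pays eps / (2 m) for the exponential moment. *)
have : 24 / m ^+ 2 <= eps / m / 2.
  have -> : eps / m / 2 = (m * eps / 2) / m ^+ 2 by field; rewrite gt_eqF.
  rewrite ler_wpM2r ?invr_ge0 ?sqr_ge0 //; lra.
lra.
Qed.

(** * From probabilities to proportions of sign patterns *)

Section SignEvents.
Context (d : measure_display) (T : measurableType d) (R : realType)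
        (P : probability T R).

Definition sign_event n (X : {RV P >-> n.-tuple R}) (a : {ffun 'I_n -> bool}) : set T :=
  [set w | forall j, tnth (X w) j = (-1) ^+ a j].

Lemma sign_event_preimage n (X : {RV P >-> n.-tuple R}) a :
  g_sigma_algebra_preimage X (sign_event X a).
Proof.
exists [set x : n.-tuple R | forall j, tnth x j = (-1) ^+ a j].
  have -> : [set x : n.-tuple R | forall j, tnth x j = (-1) ^+ a j] =
      \bigcap_(j in [set: 'I_n]) ((fun x : n.-tuple R => tnth x j) @^-1` [set (-1) ^+ a j]).
    by apply/seteqP; split => x /= h j //=; apply: h.
  apply: fin_bigcap_measurable => // j _.
  rewrite -[X in measurable X]setTI; apply: measurable_tnth => //.
by rewrite setTI.
Qed.

Lemma measurable_sign_event n (X : {RV P >-> n.-tuple R}) a :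
  measurable (sign_event X a).
Proof.
have [B mB <-] := sign_event_preimage X a.
exact: measurable_funPT.
Qed.

Lemma prob_sign_event n (X : {RV P >-> n.-tuple R}) a :
  rademacher X -> P (sign_event X a) = (2^-1 ^+ n)%:E.
Proof.
move=> [indX margX].
have -> : sign_event X a =
    \bigcap_(j in [set` [set: 'I_n]%SET]) [set w | tnth (X w) j = (-1) ^+ a j].
  by apply/seteqP; split => w /= h j //=; apply: h => //=; rewrite finset.in_setT.
rewrite indX => [|j _].
  rewrite (eq_bigr (fun=> (2^-1)%:E)) => [|j _].
    by rewrite prodEFin prodr_const cardsT card_ord.
  by case: (a j) (margX j) => -[? ?].
exists [set (-1) ^+ a j]; first exact: measurable_set1.
by rewrite setTI.
Qed.

Lemma colvec_sign_event n (X : {RV P >-> n.-tuple R}) a w :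
  sign_event X a w -> colvec (X w) = signvec R a.
Proof. by move=> h; apply/colP => j; rewrite !mxE h. Qed.

Definition joint_sign_event k m n (X : 'I_k -> {RV P >-> m.-tuple R})
    (Y : 'I_k -> {RV P >-> n.-tuple R}) (f : {ffun 'I_k -> signs m n}) : set T :=
  [set w | forall i, sign_event (X i) (f i).1 w /\ sign_event (Y i) (f i).2 w].

Lemma joint_sign_eventE k m n (X : 'I_k -> {RV P >-> m.-tuple R})
    (Y : 'I_k -> {RV P >-> n.-tuple R}) f :
  joint_sign_event X Y f = \bigcap_(s in [set` [set: 'I_k + 'I_k]%SET])
    match s with
    | inl i => sign_event (X i) (f i).1
    | inr i => sign_event (Y i) (f i).2
    end.
Proof.
apply/seteqP; split => w /= h; first by move=> [i|i] _; have [] := h i.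
by move=> i; split; [apply: (h (inl i))|apply: (h (inr i))]; rewrite /= finset.in_setT.
Qed.

Lemma measurable_joint_sign_event k m n (X : 'I_k -> {RV P >-> m.-tuple R})
    (Y : 'I_k -> {RV P >-> n.-tuple R}) f :
  measurable (joint_sign_event X Y f).
Proof.
rewrite joint_sign_eventE; apply: fin_bigcap_measurable => // -[i|i] _;
  exact: measurable_sign_event.
Qed.

Lemma prob_joint_sign_event k m n (X : 'I_k -> {RV P >-> m.-tuple R})
    (Y : 'I_k -> {RV P >-> n.-tuple R}) f :
  (forall i, rademacher (X i)) -> (forall i, rademacher (Y i)) ->
  independent_vectors X Y ->
  P (joint_sign_event X Y f) = (#|{: signs m n}|%:R^-1 ^+ k)%:E.
Proof.
move=> radX radY indXY; rewrite joint_sign_eventE indXY; last first.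
  by move=> [i|i] _; exact: sign_event_preimage.
rewrite (eq_bigl xpredT) => [|s]; last by rewrite finset.in_setT.
rewrite big_sumType /=.
under eq_bigr => i _ do rewrite (prob_sign_event _ (radX i)).
under [X in (_ * X)%E]eq_bigr => i _ do rewrite (prob_sign_event _ (radY i)).
rewrite !prodEFin -EFinM !prodr_const card_ord -exprMn card_prod !card_ffun card_bool !card_ord.
by rewrite natrM !natrX invfM !exprVn.
Qed.

Lemma trivIset_joint_sign_event k m n (X : 'I_k -> {RV P >-> m.-tuple R})
    (Y : 'I_k -> {RV P >-> n.-tuple R}) D :
  trivIset D (joint_sign_event X Y).
Proof.
move=> f g _ _ [w [hf hg]]; apply/ffunP => i.
have [hf1 hf2] := hf i; have [hg1 hg2] := hg i.
rewrite [f i]surjective_pairing [g i]surjective_pairing.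
by congr (_, _); apply/ffunP => j; apply: (@signr_inj R); rewrite -?(hf1, hf2) -?(hg1, hg2).
Qed.

(** The reduction to counting. Only a lower bound is claimed since the random
    vectors take values other than signs on a null set. *)
Lemma prob_ge_card k m n (X : 'I_k -> {RV P >-> m.-tuple R})
    (Y : 'I_k -> {RV P >-> n.-tuple R}) (A : set T) (G : pred {ffun 'I_k -> signs m n}) :
  (forall i, rademacher (X i)) -> (forall i, rademacher (Y i)) ->
  independent_vectors X Y -> measurable A ->
  (forall f w, G f -> joint_sign_event X Y f w -> A w) ->
  ((#|G|%:R / #|{: signs m n}|%:R ^+ k)%:E <= P A)%E.
Proof.
move=> radX radY indXY mA GA.
pose U := \bigcup_(f in [set` enum G]) joint_sign_event X Y f.
have mU : measurable U.
  apply: fin_bigcup_measurable => [|f _]; first exact: finite_seq.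
  exact: measurable_joint_sign_event.
apply: (@le_trans _ _ (P U)); last first.
  apply: le_measure; rewrite ?inE // => w [f /= Gf fw].
  by apply: GA fw; rewrite mem_enum in Gf.
rewrite (measure_fin_bigcup _ (finite_seq _) (@trivIset_joint_sign_event _ _ _ X Y _)); last first.
  by move=> f _; exact: measurable_joint_sign_event.
rewrite -fsbig_seq ?enum_uniq // big_enum /=.
rewrite (eq_bigr (fun=> (#|{: signs m n}|%:R^-1 ^+ k)%:E)) => [|f _]; last first.
  exact: prob_joint_sign_event.
by rewrite sumEFin sumr_const exprVn mulr_natl.
Qed.

Lemma measurable_Est k m n (B : 'M[R]_(m * n)) (X : 'I_k -> {RV P >-> m.-tuple R})
    (Y : 'I_k -> {RV P >-> n.-tuple R}) :
  measurable_fun setT (Est B X Y).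
Proof.
have mtnth l (Z : {RV P >-> l.-tuple R}) j : measurable_fun setT (fun w => tnth (Z w) j).
  by apply: (measurableT_comp (measurable_tnth j)); exact: measurable_funPT.
have mkron i p : measurable_fun setT
    (fun w => (colvec (X i w) *t colvec (Y i w)) p 0).
  under eq_fun => w do rewrite !mxE.
  exact: measurable_funM.
apply: measurable_funM => //; apply: measurable_sum => i.
under eq_fun => w do rewrite qform_eq_sum.
apply: measurable_sum => p; apply: measurable_sum => q.
by apply: measurable_funM => //; apply: measurable_funM.
Qed.

End SignEvents.

(** * The tail bound for the trace estimator *)

Unset Implicit Arguments.

Theorem theorem3p2 (R : realType) (d : measure_display) (T : measurableType d)
    (P : probability T R) (k nh nt : nat)
    (hk : (1 <= k)%N) (hnh : (1 <= nh)%N) (hnt : (1 <= nt)%N)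
    (B : 'M[R]_(nt * nh)) (hB : symmetric_psd B)
    (xt : 'I_k -> {RV P >-> nt.-tuple R})
    (xh : 'I_k -> {RV P >-> nh.-tuple R})
    (hxt : forall i, rademacher (xt i)) (hxh : forall i, rademacher (xh i))
    (hind : independent_vectors xt xh)
    (eps : R) (heps : 0 < eps)
    (hn : 48 * eps^-1 <= (nt * nh)%:R - 1) :
  ((1 - expR (- (k%:R * eps / ((nt * nh)%:R - 1))))%:E
   <= P [set w | (\tr B >= (1 + eps)^-1 * Est B xt xh w)%R])%E.
Proof.
have [tr0 qmax sum1 sum2] := kron_form_bounds hB.
set m : R := (nt * nh)%:R - 1 in hn *.
have m0 : 0 < m by apply: lt_le_trans hn; rewrite mulr_gt0 ?invr_gt0.
have meps : 48 <= m * eps by rewrite -ler_pdivrMr.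
have k0 : 0 < k%:R :> R by rewrite ltr0n.
have e1 : 0 < 1 + eps by rewrite addr_gt0.
pose q (u : signs nt nh) := kron_form B u.
pose bad := [pred f : {ffun 'I_k -> signs nt nh} |
  k%:R * ((1 + eps) * \tr B) < \sum_i q (f i)].
have card_bad : #|bad|%:R <=
    #|{: signs nt nh}|%:R ^+ k * expR (- (k%:R * eps / m)).
  apply: (@card_sum_gt_le _ _ q _ _ _ k m0 tr0) => // u.
  by rewrite /m subrK; exact: qmax.
set N := #|{: signs nt nh}|%:R ^+ k in card_bad.
have N0 : 0 < N by rewrite exprn_gt0 // ltr0n card_prod !card_ffun card_bool muln_gt0 !expn_gt0.
have mE : measurable [set w | (1 + eps)^-1 * Est B xt xh w <= \tr B].
  have mf : measurable_fun setT (fun w => (1 + eps)^-1 * Est B xt xh w).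
    by apply: measurable_funM => //; exact: measurable_Est.
  have := mf measurableT [set` `]-oo, \tr B]] (measurable_itv _).
  by rewrite setTI; congr measurable; apply/seteqP; split => w /=; rewrite in_itv.
apply: le_trans (prob_ge_card (G := [predC bad]) hxt hxh hind mE _); last first.
  move=> f w; rewrite /= -leNgt => good fw.
  rewrite ler_pdivrMl // /Est ler_pdivrMl //; apply: le_trans good.
  apply: ler_sum => i _; have [ft fh] := fw i.
  by rewrite (colvec_sign_event ft) (colvec_sign_event fh).
have -> : #|[predC bad]|%:R = N - #|bad|%:R :> R.
  have <- : #|{: {ffun 'I_k -> signs nt nh}}|%:R = N by rewrite card_ffun card_ord natrX.
  by rewrite -(cardC bad) natrD addrAC subrr add0r.
by rewrite lee_fin -/N mulrBl divff ?gt_eqF // lerD2l lerN2 ler_pdivrMr // mulrC.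
Qed.
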